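(* Let $G$ be a graph, and let $\Sigma$ be a discrete, crossing-finite, ECC system of separations of $G$. Then there exists a unique reduced, crossing-faithful median decomposition $(M,\beta)$ of $G$ such that the set of separations $\Sigma_{M,\beta}$ of $G$ induced by the $\Theta$-classes of $M$ is exactly $\Sigma$. Here uniqueness means: if $(N,\alpha)$ is another reduced, crossing-faithful median decomposition of $G$ with $\Sigma_{N,\alpha}=\Sigma$, then there is a graph isomorphism $\varphi: M\to N$ with $\alpha\circ\varphi=\beta$.
   Context: Graphs are simple, undirected, possibly infinite. Separations. A separation of $G$ is an ordered pair $(A,B)$ of subsets of $V(G)$ with $A\cup B=V(G)$ and no edge of $G$ joining $A\setminus B$ to $B\setminus A$. It is essential if $A\ne V(G)$ and $B\neq V(G)$. Its flip is $(A,B)^r=(B,A)$. Separations are partially ordered by $(A,B)\le(C,D)$ iff $A\subseteq C$ and $D\subseteq B$. Two separations are nested if $(A,B)$ is comparable with $(C,D)$ or with $(D,C)$; otherwise they cross. A system of separations is a set $\Sigma$ of essential separations closed under flips. $\Sigma$ is discrete if for all $s_1,s_2\in\Sigma$ the set $\{t\in\Sigma: s_1\le t\le s_2\}$ is finite; crossing-finite if every set of pairwise-crossing elements of $\Sigma$ is finite; ECC (escaping chain condition) if for every infinite strictly descending chain $(A_1,B_1)>(A_2,B_2)>\cdots$ in $\Sigma$ we have $\bigcap_n (A_n\setminus B_n)=\emptyset$. Median graphs. For vertices $u,v$ of a connected graph, $I(u,v)$ is the set of vertices lying on some geodesic (shortest path) from $u$ to $v$. A median graph is a connected graph in which $I(u,v)\cap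 I(v,w)\cap I(w,u)$ is a single vertex for all vertices $u,v,w$. A subgraph $C$ is convex if every geodesic with endpoints in $C$ is contained in $C$. On the oriented edges of a median graph $M$ define $(x,y)\,\Theta\,(u,v)$ iff $d(x,u)+d(y,v)<d(x,v)+d(y,u)$; this is an equivalence relation, whose classes are the oriented $\Theta$-classes; their set is $\vec{\mathcal H}(M)$. For $\mathfrak h=[(u,v)]$ put $\mathfrak h_+=\{w: d(w,u)<d(w,v)\}$ and $\mathfrak h_-=\{w: d(w,u)>d(w,v)\}$ (independent of the representative). Two oriented $\Theta$-classes $\mathfrak h,\mathfrak h'$ cross if all four sets $\mathfrak h_\pm\cap\mathfrak h'_\pm$ are non-empty. Median decompositions. A median decomposition of $G$ is a pair $(M,\beta)$ with $M$ a median graph and $\beta:V(M)\to\mathcal P(V(G))$ such that (M1) $\bigcup_u\beta(u)=V(G)$; (M2) for every edge $xy$ of $G$ some $\beta(u)$ contains $\{x,y\}$; (M3) for every $v\in V(G)$ the fibre $\beta^{-1}(v)=\{u\in V(M): v\in\beta(u)\}$ induces a convex subgraph of $M$. For $\mathfrak h\in\vec{\mathcal H}(M)$ the separation induced by $\mathfrak h$ is $(A_{\mathfrak h},B_{\mathfrak h})$ with $A_{\mathfrak h}=\bigcup_{u\in\mathfrak h_+}\beta(u)$ and $B_{\mathfrak h}=\bigcup_{u\in\mathfrak h_-}\beta(u)$, and $\Sigma_{M,\beta}=\{(A_{\mathfrak h},B_{\mathfrak h}):\mathfrak h\in\vec{\mathcal H}(M)\}$. $(M,\beta)$ is reduced if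 every $(A_{\mathfrak h},B_{\mathfrak h})$ is essential and the map $\mathfrak h\mapsto(A_{\mathfrak h},B_{\mathfrak h})$ is injective. It is crossing-faithful if whenever $\mathfrak h,\mathfrak h'$ cross, the induced separations $(A_{\mathfrak h},B_{\mathfrak h})$ and $(A_{\mathfrak h'},B_{\mathfrak h'})$ also cross. *)

(* Defs.v *)
From mathcomp Require Import all_boot.
From mathcomp Require Import boolp classical_sets functions cardinality.
From Stdlib Require List.

Set Implicit Arguments.
Unset Strict Implicit.
Unset Printing Implicit Defensive.

Local Open Scope classical_set_scope.

(* Adjacency is boolean so that the library's [path] applies; with the
   classical axioms of boolp every Prop-valued relation has this form. *)
Record graph := Graph {
  vertex :> Type;
  adj : rel vertex;
  adj_sym : symmetric adj;
  adj_irrefl : irreflexive adj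
}.

Section Separations.
Variable G : graph.

Definition sep : Type := (set G * set G)%type.

Definition is_separation (s : sep) : Prop :=
  s.1 `|` s.2 = setT /\
  (forall x y : G, (s.1 `\` s.2) x -> (s.2 `\` s.1) y -> ~~ adj x y).

Definition essential (s : sep) : Prop := s.1 <> setT /\ s.2 <> setT.

Definition flip (s : sep) : sep := (s.2, s.1).

Definition sep_le (s t : sep) : Prop := s.1 `<=` t.1 /\ t.2 `<=` s.2.

Definition sep_lt (s t : sep) : Prop := sep_le s t /\ s <> t.

Definition comparable (s t : sep) : Prop := sep_le s t \/ sep_le t s.

Definition nested (s t : sep) : Prop := comparable s t \/ comparable s (flip t).

Definition sep_cross (s t : sep) : Prop := ~ nested s t.

Definition separation_system (S : set sep) : Prop :=
  forall s, S s -> [/\ is_separation s, essential s & S (flip s)].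

Definition discrete (S : set sep) : Prop :=
  forall s1 s2, S s1 -> S s2 ->
    finite_set [set t | [/\ S t, sep_le s1 t & sep_le t s2]].

Definition crossing_finite (S : set sep) : Prop :=
  forall X : set sep, X `<=` S ->
    (forall s t, X s -> X t -> s <> t -> sep_cross s t) -> finite_set X.

Definition ECC (S : set sep) : Prop :=
  forall s : nat -> sep, (forall n, S (s n)) ->
    (forall n, sep_lt (s n.+1) (s n)) ->
    \bigcap_n ((s n).1 `\` (s n).2) = set0.

End Separations.

Section MedianGraphs.
Variable M : graph.

(* The walk visits x :: p; its length is [size p]. *)
Definition walk (x y : M) (p : seq M) : Prop := path (@adj M) x p /\ last x p = y.

(* A walk of minimum length repeats no vertex, so these are the shortest paths. *)
Definition geodesic (x y : M) (p : seq M) : Prop :=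
  walk x y p /\ (forall q, walk x y q -> size p <= size q).

(* The null graph is not connected. *)
Definition connected : Prop :=
  inhabited M /\ (forall x y : M, exists p, walk x y p).

(* The least length of a walk from x to y, and 0 (a junk value) if there is none. *)
Definition dist (x y : M) : nat :=
  if pselect (exists n, `[< exists2 p, walk x y p & size p = n >]) is left ex
  then ex_minn ex else 0.

Definition interval (u v : M) : set M :=
  [set w | exists2 p, geodesic u v p & List.In w (u :: p)].

Definition median_graph : Prop :=
  connected /\
  (forall u v w : M, exists x,
     interval u v `&` interval v w `&` interval w u = [set x]).

(* Convexity of the subgraph induced by C: being induced, it contains a
   geodesic as soon as it contains the vertices of that geodesic. *)
Definition convex (C : set M) : Prop :=
  forall u v p, C u -> C v -> geodesic u v p ->
    forall w, List.In w (u :: p) -> C w.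

Definition oriented_edge : set (M * M) := [set e | adj e.1 e.2].

Definition Theta (e f : M * M) : Prop :=
  dist e.1 f.1 + dist e.2 f.2 < dist e.1 f.2 + dist e.2 f.1.

Definition Theta_class (e : M * M) : set (M * M) :=
  [set f | oriented_edge f /\ Theta e f].

Definition Theta_classes : set (set (M * M)) := Theta_class @` oriented_edge.

(* In a median graph the two half-spaces of a Theta-class do not depend on
   the representative e. *)
Definition hplus (h : set (M * M)) : set M :=
  [set w | exists2 e, h e & dist w e.1 < dist w e.2].

Definition hminus (h : set (M * M)) : set M :=
  [set w | exists2 e, h e & dist w e.1 > dist w e.2].

Definition class_cross (h h' : set (M * M)) : Prop :=
  [/\ hplus h `&` hplus h' !=set0, hplus h `&` hminus h' !=set0,
      hminus h `&` hplus h' !=set0 & hminus h `&` hminus h' !=set0].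

End MedianGraphs.

Section MedianDecompositions.
Variables G M : graph.
Implicit Type beta : M -> set G.

Record median_decomposition beta : Prop := MedianDecomposition {
  md_median : median_graph M;
  md_cover : \bigcup_u beta u = setT;
  md_edge : forall x y : G, adj x y -> exists u, beta u x /\ beta u y;
  md_convex : forall v : G, convex [set u | beta u v]
}.

Definition induced_sep beta (h : set (M * M)) : sep G :=
  (\bigcup_(u in hplus h) beta u, \bigcup_(u in hminus h) beta u).

Definition induced_system beta : set (sep G) :=
  induced_sep beta @` @Theta_classes M.

Definition reduced beta : Prop :=
  (forall h, Theta_classes h -> essential (induced_sep beta h)) /\
  set_inj (@Theta_classes M) (induced_sep beta).

Definition crossing_faithful beta : Prop :=
  forall h h', Theta_classes h -> Theta_classes h' -> class_cross h h' ->
    sep_cross (induced_sep beta h) (induced_sep beta h').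

End MedianDecompositions.

Definition graph_iso (M N : graph) (phi : M -> N) : Prop :=
  bijective phi /\ (forall x y : M, adj (phi x) (phi y) = adj x y).

(* Main.v *)
(* The vertices of M are the orientations of S: the upward closed choices of one
   of s, flip s for every s in S that have no infinite descending chain.  Two of
   them are adjacent when they differ in a single separation.  They differ in
   finitely many separations because such a difference has neither infinite
   chains nor infinite antichains, so distance is the size of the difference, the
   median is the majority vote, and the half-spaces are the sets {u | s in u}.
   The bag of u is the intersection of the sides A_s for s in u.  By ECC the
   separations strictly containing a given vertex or edge of G on one side have no
   infinite descending chain, and a maximal crossing family guides the choice of
   an orientation of the remaining ones; so bags cover G and its edges.

   For uniqueness, every vertex n of a decomposition N yields the orientation of
   all s_h with n in h_+.  Half-spaces of a median graph are convex, and convex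
   sets have gates; if s is minimal in the orientation at n, the first class met on
   the way from n to the gate of the other side of s must be s itself, so every
   neighbour in M is realised in N and the map is an isomorphism.  The same gate
   argument, applied to the fibre of a vertex of G, identifies the bags. *)
Require Import Defs.
From mathcomp Require Import all_boot.
From mathcomp Require Import boolp classical_sets functions cardinality finmap zify.
From Stdlib Require List.

Set Implicit Arguments.
Unset Strict Implicit.
Unset Printing Implicit Defensive.

Local Open Scope classical_set_scope.

(** * Chains and antichains *)

Section Chains.
Variable T : Type.
Implicit Types (lt : T -> T -> Prop) (D E : set T).

Definition chain_free lt D :=
  ~ exists f : nat -> T, forall n, D (f n) /\ lt (f n.+1) (f n).

Lemma chain_freeS lt D E : E `<=` D -> chain_free lt D -> chain_free lt E.
Proof.
by move=> ED noD [f fP]; apply: noD; exists f => n; have [/ED] := fP n.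
Qed.

(** Dependent choice on the subtype of [D], so that membership is carried along the chain. *)
Lemma choice_sequence lt D x : D x ->
  (forall y, D y -> exists2 z, D z & lt z y) -> ~ chain_free lt D.
Proof.
move=> Dx next; apply; pose X := {y | D y}.
have [|f [_ fP]] := @dependent_choice X (fun y z => lt (sval z) (sval y))
  _ (exist _ x Dx).
  by move=> [y Dy]; apply: cid; have [z Dz zy] := next y Dy; exists (exist _ z Dz).
by exists (sval \o f) => n; split; [exact: svalP (f n) | exact: fP].
Qed.

Variable lt : T -> T -> Prop.
Hypothesis lt_irr : forall x, ~ lt x x.
Hypothesis lt_trans : forall x y z, lt x y -> lt y z -> lt x z.

Lemma minimal_below D E x : chain_free lt D -> E `<=` D -> E x ->
  exists m, [/\ E m, m = x \/ lt m x & forall y, E y -> ~ lt y m].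
Proof.
move=> noD ED Ex; apply: contrapT => nomin.
apply: (@choice_sequence lt [set y | E y /\ (y = x \/ lt y x)] x).
- by split=> //; left.
- move=> y [Ey yx]; apply: contrapT => noz; apply: nomin; exists y.
  split=> // z Ez zy; apply: noz; exists z => //; split=> //; right.
  by case: yx => [<-//|]; exact: lt_trans.
- by apply: chain_freeS noD => y [/ED].
Qed.

(** A descending sequence either returns to [D] infinitely often, and by transitivity those terms
    form a chain, or has a tail in [E]. *)
Lemma chain_freeU D E : chain_free lt D -> chain_free lt E -> chain_free lt (D `|` E).
Proof.
move=> noD noE [f fP].
have lt_f i j : i < j -> lt (f j) (f i).
  elim: j => // j IH; rewrite ltnS leq_eqVlt => /orP[/eqP->|/IH ji].
    by have [] := fP j.
  by apply: lt_trans ji; have [] := fP j.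
have [oftenD|] := pselect (forall i, exists2 j, i < j & D (f j)).
  have [i _ Di] := oftenD 0.
  apply: (@choice_sequence lt [set x | D x /\ exists j, x = f j] (f i)).
  - by split=> //; exists i.
  - move=> _ [_ [j ->]]; have [k jk Dk] := oftenD j; exists (f k).
      by split=> //; exists k.
    exact: lt_f.
  - by apply: chain_freeS noD => x [].
move=> /existsNP[i iP]; apply: noE; exists (fun k => f (i.+1 + k)) => k.
split; last by rewrite addnS; have [] := fP (i.+1 + k).
have [[Df|//] _] := fP (i.+1 + k); case: iP; exists (i.+1 + k) => //.
by rewrite addSn ltnS leq_addr.
Qed.

Lemma finite_chain_free D : finite_set D -> chain_free lt D.
Proof.
move=> finD [f fP].
have lt_f i j : i < j -> lt (f j) (f i).
  elim: j => // j IH; rewrite ltnS leq_eqVlt => /orP[/eqP->|/IH ji].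
    by have [] := fP j.
  by apply: lt_trans ji; have [] := fP j.
have f_inj : injective f.
  move=> i j ij; have [/lt_f|/lt_f|//] := ltngtP i j;
    by rewrite ij => /lt_irr.
apply: infinite_nat; apply: (@sub_finite_set _ _ (f @^-1` D)).
  by move=> n _; have [] := fP n.
by apply: finite_preimage => // i j _ _; exact: f_inj.
Qed.

(* If D were infinite, one of its finitely many minimal elements would have
   infinitely many elements above it; iterating yields an ascending chain. *)
Lemma finite_of_chain_free D : chain_free lt D -> chain_free (fun x y => lt y x) D ->
  (forall A, A `<=` D -> (forall x y, A x -> A y -> ~ lt x y) -> finite_set A) ->
  finite_set D.
Proof.
move=> noD noU antiD.
have above E : E `<=` D -> infinite_set E ->
    exists2 m, E m & infinite_set (E `&` [set x | lt m x]).
  move=> ED infE; apply: contrapT => noM; apply: infE.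
  pose Mn := [set m | E m /\ forall y, E y -> ~ lt y m].
  have finM : finite_set Mn.
    by apply: antiD => [x [/ED]//|x y [Ex _] [_ ymin]]; exact: ymin.
  (* By [minimal_below], [E] is covered by its minimal elements and the parts strictly above
     them. *)
  apply: (@sub_finite_set _ _ (Mn `|` \bigcup_(m in Mn) (E `&` [set x | lt m x]))).
    move=> x Ex; have [m [Em [->|mx] mmin]] := minimal_below noD ED Ex.
      by left.
    by right; exists m.
  rewrite finite_setU; split=> //; apply: bigcup_finite => // m [Em _].
  by apply: contrapT => inf; apply: noM; exists m.
apply: contrapT => infD; have [m0 Dm0 inf0] := above D (@subset_refl _ D) infD.
pose R := [set m | D m /\ infinite_set (D `&` [set x | lt m x])].
apply: (@choice_sequence (fun x y => lt y x) R m0); first by split.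
- move=> y [Dy infy].
  have [|z [Dz yz] infz] := above (D `&` [set x | lt y x]) _ infy.
    by move=> ? [].
  exists z => //; split=> //; apply: sub_infinite_set infz.
  by move=> x [[Dx _] zx].
- by apply: chain_freeS noU => ? [].
Qed.

End Chains.

(** * Distance and convexity *)

Section Distance.
Variable M : graph.
Implicit Types (x y z u v w : M) (p q : seq M).

Lemma walk_nil x : walk x x [::].
Proof. by []. Qed.

Lemma walk_cons x y z p : adj x y -> walk y z p -> walk x z (y :: p).
Proof. by move=> xy [yp lp]; split=> //=; rewrite xy. Qed.

Lemma walk_cat x y z p q : walk x y p -> walk y z q -> walk x z (p ++ q).
Proof.
by move=> [xp lp] [yq lq]; split; rewrite ?cat_path ?last_cat ?lp ?xp.
Qed.

Lemma walk_rev x y p : walk x y p -> exists2 q, walk y x q & size q = size p.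
Proof.
elim: p x => [|z p IH] x [/=]; first by move=> _ <-; exists [::].
move=> /andP[xz zp] lp; have [//|q yq sq] := IH z.
exists (q ++ [:: x]); last by rewrite size_cat sq addn1.
by apply: (walk_cat yq); apply: walk_cons (walk_nil _); rewrite adj_sym.
Qed.

Lemma walk_split x y w p : walk x y p -> List.In w (x :: p) ->
  exists q r, [/\ walk x w q, walk w y r & size p = size q + size r].
Proof.
elim: p x => [|z p IH] x xyp.
  by case=> // <-; exists [::], [::].
case=> [<-|wzp]; first by exists [::], (z :: p).
have [/= /andP[xz zp] lp] := xyp.
have [//|q [r [zq wr e]]] := IH z _ wzp.
by exists (z :: q), r; split=> //=; [exact: walk_cons|rewrite e].
Qed.

Lemma In_walk_cat x y p q : walk x y p -> List.In y (x :: p ++ q).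
Proof.
elim: p x => [|z p IH] x [/=]; first by move=> _ ->; left.
by move=> /andP[_ zp] lp; right; exact: IH.
Qed.

Lemma dist_min x y p : walk x y p ->
  (exists2 q, walk x y q & size q = dist x y) /\ dist x y <= size p.
Proof.
move=> xyp; rewrite /dist; case: pselect => [ex|[]]; last first.
  by exists (size p); apply/asboolP; exists p.
case: ex_minnP => n /asboolP[q xyq sq] nmin; split; first by exists q.
by apply: nmin; apply/asboolP; exists p.
Qed.

Lemma dist_le x y p : walk x y p -> dist x y <= size p.
Proof. by move=> /dist_min[]. Qed.

Hypothesis conM : connected M.

Lemma dist_walk x y : exists2 p, walk x y p & size p = dist x y.
Proof. by have [p /dist_min[]] := conM.2 x y. Qed.

Lemma geodesicP x y p : geodesic x y p <-> walk x y p /\ size p = dist x y.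
Proof.
split=> [[xyp pmin]|[xyp sp]]; split=> //; last by move=> q; rewrite sp; exact: dist_le.
have [q xyq sq] := dist_walk x y.
by apply/eqP; rewrite eqn_leq dist_le// -sq pmin.
Qed.

Lemma distxx x : dist x x = 0.
Proof. by apply/eqP; rewrite -leqn0; exact: (dist_le (walk_nil x)). Qed.

Lemma dist_eq0 x y : dist x y = 0 -> x = y.
Proof. by have [[|z p] [_ <-]//] := dist_walk x y => /= <-. Qed.

Lemma dist_triangle y x z : dist x z <= dist x y + dist y z.
Proof.
have [p xyp <-] := dist_walk x y; have [q yzq <-] := dist_walk y z.
by rewrite -size_cat; apply: dist_le; exact: walk_cat yzq.
Qed.

Lemma dist_symm x y : dist x y = dist y x.
Proof.
suff le u v : dist u v <= dist v u by apply/eqP; rewrite eqn_leq !le.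
by have [p /walk_rev[q uvq <-] <-] := dist_walk v u; exact: dist_le.
Qed.

Lemma dist_adj x y : adj x y -> dist x y = 1.
Proof.
move=> xy; apply/eqP; rewrite eqn_leq (dist_le (walk_cons xy (walk_nil y))).
rewrite lt0n; apply/eqP => /dist_eq0 exy.
by move: xy; rewrite exy adj_irrefl.
Qed.

Lemma dist_step x y : x <> y -> exists2 z, adj x z & dist x y = (dist z y).+1.
Proof.
move=> xy; have [[|z p] [/= xp lp] sp] := dist_walk x y; first by rewrite lp in xy.
move: xp => /andP[xz zp]; exists z => //; apply/eqP; rewrite eqn_leq.
have := dist_triangle z x y; rewrite (dist_adj xz) add1n => ->/=.
by rewrite -sp ltnS; apply: dist_le.
Qed.

Lemma intervalP u v w : interval u v w <-> dist u w + dist w v = dist u v.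
Proof.
split=> [[p /geodesicP[uvp sp] wp]|e].
  have [q [r [uq wr e]]] := walk_split uvp wp.
  apply/eqP; rewrite eqn_leq dist_triangle andbT -sp e.
  by apply: leq_add; exact: dist_le.
have [p uwp sp] := dist_walk u w; have [q wvq sq] := dist_walk w v.
exists (p ++ q); last exact: In_walk_cat uwp.
by apply/geodesicP; rewrite size_cat sp sq; split=> //; exact: walk_cat wvq.
Qed.

Lemma convexP (C : set M) : convex C <->
  forall u v w, C u -> C v -> dist u w + dist w v = dist u v -> C w.
Proof.
split=> cC u v.
  by move=> w Cu Cv /intervalP[p guvp wp]; exact: cC guvp _ wp.
by move=> p Cu Cv guvp w wp; apply: (cC u v) => //; apply/intervalP; exists p.
Qed.

(** The tail of a geodesic is again a geodesic, so induction along it reduces convexity to its first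
    edge. *)
Lemma convex_step (C : set M) :
  (forall x y z, C x -> C y -> adj x z -> dist x y = (dist z y).+1 -> C z) ->
  convex C.
Proof.
move=> step u v p Cu Cv [uvp pmin] w.
have {pmin} : size p = dist u v by have [] := (geodesicP u v p).1 (conj uvp pmin).
elim: p u uvp Cu => [|z p IH] u uvp Cu; first by move=> _ [<-|[]].
move: (uvp) => [/= /andP[uz zp] lp] sp; case=> [<-//|].
have zvp : walk z v p by [].
have dz : dist z v = size p.
  apply/eqP; rewrite eqn_leq dist_le//=.
  by have := dist_triangle z u v; rewrite (dist_adj uz) -sp add1n ltnS.
by apply: IH => //; apply: (step u v) => //; rewrite dz.
Qed.

End Distance.

(** * Half-spaces of median graphs *)

(** Describes one side of a Theta-class through a single representative edge; [hplusE] and [hminusE]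
    recover the official half-spaces. *)
Definition halfspace (M : graph) (e : M * M) : set M :=
  [set w | dist w e.1 < dist w e.2].

Definition swap (T : Type) (e : T * T) := (e.2, e.1).

Section MedianTheory.
Variable M : graph.
Hypothesis medM : median_graph M.
Let conM : connected M := medM.1.
Implicit Types (u v w x y z m : M) (e f : M * M).

Lemma median_ex x y z : exists m, [/\ dist x m + dist m y = dist x y,
  dist y m + dist m z = dist y z & dist z m + dist m x = dist z x].
Proof.
have [m mE] := medM.2 x y z; exists m.
have : [set m] m by [].
by rewrite -mE => -[[/(intervalP conM) ? /(intervalP conM) ?] /(intervalP conM)].
Qed.

Lemma median_uniq x y z m m' :
  dist x m + dist m y = dist x y -> dist y m + dist m z = dist y z ->
  dist z m + dist m x = dist z x ->
  dist x m' + dist m' y = dist x y -> dist y m' + dist m' z = dist y z ->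
  dist z m' + dist m' x = dist z x -> m = m'.
Proof.
have [n nE] := medM.2 x y z.
have inn k : dist x k + dist k y = dist x y -> dist y k + dist k z = dist y z ->
    dist z k + dist k x = dist z x -> k = n.
  move=> h1 h2 h3; suff : [set n] k by [].
  by rewrite -nE; split; [split|]; apply/(intervalP conM).
by move=> *; rewrite [m]inn //; apply: esym; exact: inn.
Qed.

(** Median graphs are bipartite: the median of [u], [v], [w] lies on the edge, hence is [u] or
    [v]. *)
Lemma dist_adj_parity u v w : adj u v ->
  dist w v = (dist w u).+1 \/ dist w u = (dist w v).+1.
Proof.
move=> uv; have [m [h1 h2 h3]] := median_ex u v w.
have duv := dist_adj conM uv.
have [m0|m0] : dist u m = 0 \/ dist m v = 0 by lia.
- left; move: h2; rewrite -(dist_eq0 conM m0) (dist_symm conM v u).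
  by rewrite !(dist_symm conM w) duv.
- right; move: h3; rewrite (dist_eq0 conM m0) (dist_symm conM v u) duv.
  by rewrite addn1.
Qed.

Lemma halfspace_swap e : oriented_edge e -> halfspace (swap e) = ~` halfspace e.
Proof.
case: e => u v uv; have {}uv : adj u v := uv; apply/seteqP; rewrite /halfspace /setC /mkset/=.
by split=> w /=; have := dist_adj_parity w uv; lia.
Qed.

Lemma halfspace_fst e : oriented_edge e -> halfspace e e.1.
Proof. by move=> ee; rewrite /halfspace/= distxx (dist_adj conM ee). Qed.

Lemma halfspace_snd e : oriented_edge e -> ~ halfspace e e.2.
Proof. by move=> ee; rewrite /halfspace/= distxx. Qed.

Lemma oriented_edge_swap e : oriented_edge (swap e) <-> oriented_edge e.
Proof. by rewrite /oriented_edge/= adj_sym. Qed.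

(* Along an edge [x z] leaving the half-space towards [y], the medians of
   [x, y, v] computed on either side of the edge [u v] would be distinct. *)
Lemma halfspace_convex e : oriented_edge e -> convex (halfspace e).
Proof.
case: e => u v uv; have {}uv : adj u v := uv; apply: (convex_step conM) => x y z.
rewrite /halfspace/= => xW yW xz xyz; apply/negP => /negP zW.
have tri := dist_triangle conM; have sym := dist_symm conM.
have zx := dist_adj conM xz; rewrite (sym x z) in zx.
have pz : dist z u = (dist z v).+1 by have := dist_adj_parity z uv; lia.
have px : dist x v = (dist x u).+1 by have := dist_adj_parity x uv; lia.
have py : dist y v = (dist y u).+1 by have := dist_adj_parity y uv; lia.
have zvxu : dist z v = dist x u.
  by have := tri z x v; have := tri x z u; rewrite (sym x z) => *; lia.
have [m [h1 h2 h3]] := median_ex x y u.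
have [m' [k1 k2 k3]] := median_ex z y v.
rewrite !(sym u) (sym m x) in h3; rewrite !(sym v) (sym m' z) in k3.
have pm : dist m v = (dist m u).+1.
  by have := dist_adj_parity m uv; have := tri m x v; lia.
have pm' : dist m' u = (dist m' v).+1.
  by have := dist_adj_parity m' uv; have := tri m' z u; lia.
(* [m] lies on the side of [u] and [m'] on the side of [v], yet both are medians of [x], [y],
   [v]. *)
suff mm' : m = m' by move: pm pm'; rewrite mm'; lia.
have xm' : dist x m' = (dist z m').+1.
  have := tri z x m'; have := tri m' x y; rewrite (sym x z) xyz -k1 zx.
  by rewrite add1n => le1 le2; lia.
apply: (@median_uniq x y v).
- exact: h1.
- by rewrite pm py addnS h2.
- by rewrite !(sym v) pm px addSn (sym m x) h3.
- by rewrite xm' addSn k1 xyz.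
- exact: k2.
- by rewrite !(sym v) (sym m' x) xm' px addnS k3 zvxu.
Qed.

Lemma halfspace_between e x y z : oriented_edge e -> halfspace e x -> halfspace e y ->
  dist x z + dist z y = dist x y -> halfspace e z.
Proof. by move=> ee; move/(convexP conM): (halfspace_convex ee); apply. Qed.

(** By parity the two sides of the inequality in [Theta] differ by a sum of two terms equal to 1 or
    -1, so strictness forces both to be 1. *)
Lemma ThetaE e f : oriented_edge e -> oriented_edge f ->
  Theta e f <-> [/\ halfspace f e.1 & halfspace (swap f) e.2].
Proof.
case: e f => u v [x y] uv xy; have {}uv : adj u v := uv; have {}xy : adj x y := xy; rewrite /Theta /halfspace/=.
have [] := dist_adj_parity u xy; have [] := dist_adj_parity v xy;
  by move=> -> ->; split=> [|[]]; [move=> ?; split|]; lia.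
Qed.

Lemma Theta_sym e f : Theta e f -> Theta f e.
Proof.
rewrite /Theta !(dist_symm conM e.1) !(dist_symm conM e.2).
by rewrite [X in _ < X]addnC.
Qed.

(** If [w] were closer to [f.2], then [f.2] would lie between [w] and [f.1], and convexity would put
    it in [halfspace e], on the wrong side. *)
Lemma Theta_halfspace_sub e f : oriented_edge e -> oriented_edge f ->
  Theta e f -> halfspace e `<=` halfspace f.
Proof.
move=> ee ef /Theta_sym th w ew; apply: contrapT.
have [e1 e2] := (ThetaE ef ee).1 th.
move=> nfw; have fw : halfspace (swap f) w by rewrite (halfspace_swap ef).
have : ~ halfspace e f.2 by move: e2; rewrite (halfspace_swap ee).
apply; apply: (halfspace_between ee ew e1).
rewrite (dist_symm conM f.2) (dist_adj conM ef) addn1.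
by have := dist_adj_parity w ef; move: fw; rewrite /halfspace/=; lia.
Qed.

Lemma Theta_halfspace e f : oriented_edge e -> oriented_edge f ->
  Theta e f -> halfspace e = halfspace f.
Proof.
move=> ee ef th; apply/seteqP.
by split; apply: Theta_halfspace_sub => //; exact: Theta_sym.
Qed.

Lemma halfspace_Theta e f : oriented_edge e -> oriented_edge f ->
  halfspace e = halfspace f -> Theta e f.
Proof.
move=> ee ef hef; apply/ThetaE => //; rewrite (halfspace_swap ef) -hef.
by split; [exact: halfspace_fst|exact: halfspace_snd].
Qed.

(** Transitivity of [Theta] comes for free here, since related edges are exactly those with equal
    half-spaces. *)
Lemma Theta_class_eqP e f : oriented_edge e -> oriented_edge f ->
  Theta_class e = Theta_class f <-> halfspace e = halfspace f.
Proof.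
move=> ee ef; split=> [h|h].
  have [_ th] : Theta_class f e.
    by rewrite -h; split=> //; exact: halfspace_Theta.
  by apply/esym; exact: Theta_halfspace.
have Th g : oriented_edge g -> Theta e g <-> Theta f g.
  move=> eg; split=> th; apply: halfspace_Theta => //.
    by rewrite -h; exact: Theta_halfspace.
  by rewrite h; exact: Theta_halfspace.
by apply/seteqP; split=> g [eg /(Th g eg) ?].
Qed.

Lemma hplusE e : oriented_edge e -> hplus (Theta_class e) = halfspace e.
Proof.
move=> ee; apply/seteqP; split=> w.
  by move=> [f [ef th] fw]; rewrite (Theta_halfspace ee ef th).
by move=> ew; exists e => //; split=> //; exact: halfspace_Theta.
Qed.

Lemma hminusE e : oriented_edge e -> hminus (Theta_class e) = halfspace (swap e).
Proof.
move=> ee; apply/seteqP; split=> w.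
  move=> [f [ef th] fw]; rewrite (halfspace_swap ee) (Theta_halfspace ee ef th).
  by rewrite -(halfspace_swap ef).
by move=> ew; exists e => //; split=> //; exact: halfspace_Theta.
Qed.

(** The gate is a point [y] of [C] nearest to [x]: the median of [x], [y], [z] lies in [C] by
    convexity and between [x] and [y], so it equals [y]. *)
Lemma convex_gate (C : set M) x : convex C -> C !=set0 ->
  exists2 y, C y & forall z, C z -> dist x y + dist y z = dist x z.
Proof.
move=> /(convexP conM) cC [c Cc].
have [n [y Cy <-] ymin] : exists2 n, (exists2 y, C y & dist x y = n) &
    forall z, C z -> n <= dist x z.
  have ex : exists n, `[< exists2 y, C y & dist x y = n >].
    by exists (dist x c); apply/asboolP; exists c.
  case: (ex_minnP ex) => n /asboolP nP nmin; exists n => // z Cz.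
  by apply: nmin; apply/asboolP; exists z.
exists y => // z Cz; have [m [h1 h2 h3]] := median_ex x y z.
have := ymin m (cC _ _ _ Cy Cz h2) => le.
have m0 : dist m y = 0 by lia.
move: h3; rewrite (dist_eq0 conM m0) !(dist_symm conM z) (dist_symm conM y x).
by rewrite addnC.
Qed.

Lemma adj_halfspace x y : adj x y -> forall e, oriented_edge e ->
  halfspace e x -> ~ halfspace e y -> halfspace e = halfspace (x, y).
Proof.
move=> xy e ee ex ey; apply: Theta_halfspace => //.
apply: Theta_sym; apply/(ThetaE (e := (x, y))) => //=.
by rewrite (halfspace_swap ee).
Qed.

Lemma separating_edge x y : x <> y ->
  exists2 z, adj x z & ~ halfspace (x, z) y.
Proof.
move=> /(dist_step conM)[z xz xyz]; exists z => //.
by rewrite /halfspace/= !(dist_symm conM y) xyz; lia.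
Qed.

(** The edge is the first one towards the gate [y] of [x]. A point of [C] in [halfspace (x, z)]
    would drag [y] into it, as [y] lies between [x] and that point. *)
Lemma convex_separation (C : set M) x : convex C -> C !=set0 -> ~ C x ->
  exists2 z, adj x z & C `<=` ~` halfspace (x, z).
Proof.
move=> cC C0 nCx; have [y Cy gate] := convex_gate x cC C0.
have [|z xz yz] := @separating_edge x y; first by move=> xy; rewrite xy in nCx.
exists z => // w Cw zw; apply: yz; have xx := @halfspace_fst (x, z) xz.
exact: (halfspace_between (e := (x, z)) xz xx zw (gate w Cw)).
Qed.

(** Each edge of a geodesic from [x] to [y] leaves only one half-space, by [adj_halfspace]. *)
Lemma separators_finite x y :
  finite_set [set H | [/\ H x, ~ H y & exists2 e, oriented_edge e & H = halfspace e]].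
Proof.
have [n] := ubnP (dist x y); elim: n x => // n IH x lxy.
have [->|/(dist_step conM)[z xz xyz]] := pselect (x = y).
  by apply: (sub_finite_set _ (finite_set0 _)) => H [].
apply: (@sub_finite_set _ _ ([set halfspace (x, z)] `|`
    [set H | [/\ H z, ~ H y & exists2 e, oriented_edge e & H = halfspace e]])).
  move=> H [Hx Hy [e ee eH]]; have [Hz|Hz] := pselect (H z).
    by right; split=> //; exists e.
  by left; rewrite /= eH; apply: adj_halfspace => //; rewrite -eH.
by rewrite finite_setU; split; [exact: finite_set1|apply: IH; lia].
Qed.

End MedianTheory.

(** * Orientations of a system of separations *)

Section SeparationOrder.
Variable G : graph.
Implicit Types s t r : sep G.

Lemma flipK s : flip (flip s) = s.
Proof. by case: s. Qed.

Lemma sep_lexx s : sep_le s s.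
Proof. by split. Qed.

Lemma sep_le_trans s t r : sep_le s t -> sep_le t r -> sep_le s r.
Proof. by move=> [? ?] [? ?]; split; apply: subset_trans; eassumption. Qed.

Lemma sep_le_anti s t : sep_le s t -> sep_le t s -> s = t.
Proof.
case: s t => [a b] [c d] [/= ac db] [/= ca bd].
by congr pair; apply/seteqP.
Qed.

Lemma sep_le_flip s t : sep_le (flip s) (flip t) <-> sep_le t s.
Proof. by split=> -[]. Qed.

Lemma sep_lt_irr s : ~ sep_lt s s.
Proof. by case. Qed.

Lemma sep_lt_le_trans s t r : sep_lt s t -> sep_le t r -> sep_lt s r.
Proof.
move=> [st nst] tr; split; first exact: sep_le_trans tr.
by move=> sr; apply: nst; apply: sep_le_anti; rewrite // sr.
Qed.

Lemma sep_lt_trans s t r : sep_lt s t -> sep_lt t r -> sep_lt s r.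
Proof. by move=> st [tr _]; exact: sep_lt_le_trans tr. Qed.

Lemma sep_lt_flip s t : sep_lt s t -> sep_lt (flip t) (flip s).
Proof.
move=> [st nst]; split; first exact/sep_le_flip.
by move=> /(congr1 (@flip G)); rewrite !flipK => /esym.
Qed.

Lemma sep_le_eqVlt s t : sep_le s t -> s = t \/ sep_lt s t.
Proof. by move=> st; have [|] := pselect (s = t); [left|right]. Qed.

Lemma nested_sym s t : nested s t -> nested t s.
Proof.
by case=> -[[h1 h2]|[h1 h2]]; [left; right|left; left|right; left|right; right].
Qed.

Lemma cross_sym s t : sep_cross s t -> sep_cross t s.
Proof. by move=> st /nested_sym. Qed.

End SeparationOrder.

Definition pairwise_crossing (G : graph) (F : set (sep G)) :=
  forall s t, F s -> F t -> s <> t -> sep_cross s t.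

(** In the language of pocsets, these are the ultrafilters with the descending chain condition. *)
Record orientation (G : graph) (S u : set (sep G)) : Prop := Orientation {
  orientation_sub : u `<=` S;
  orientation_flip : forall s, S s -> u (flip s) <-> ~ u s;
  orientation_up : forall s t, u s -> S t -> sep_le s t -> u t;
  orientation_dcc : chain_free (@sep_lt G) u }.

Section SeparationSystem.
Variables (G : graph) (S : set (sep G)).
Hypothesis sysS : separation_system S.
Implicit Types s t r e : sep G.

Lemma system_flip s : S s -> S (flip s).
Proof. by move=> /sysS[]. Qed.

(** Otherwise [s.2] contains both sides of [t], hence all of [G], and [s] is not essential. *)
Lemma not_le_both s t : S s -> S t -> sep_le s t -> sep_le s (flip t) -> False.
Proof.
move=> /sysS[_ [_ s2] _] /sysS[[cov _] _ _] [_ h1] [_ h2]; apply: s2.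
apply/seteqP; split=> // x _; have : (t.1 `|` t.2) x by rewrite cov.
by case=> [/h2|/h1].
Qed.

Lemma not_le_flip s : S s -> ~ sep_le s (flip s).
Proof. by move=> Ss le; exact: (not_le_both Ss Ss (sep_lexx s)). Qed.

Lemma maximal_crossing (Q F0 : set (sep G)) :
  F0 `<=` Q -> pairwise_crossing F0 ->
  exists F, [/\ F0 `<=` F, F `<=` Q, pairwise_crossing F &
    forall s, Q s -> ~ F s -> exists2 t, F t & nested t s].
Proof.
move=> F0Q cr0.
(* [F0] is adjoined to [F] rather than required to lie in it, so that the union of the empty chain
   also belongs to [fam]. *)
pose fam := [set F : set (sep G) | F `<=` Q /\ pairwise_crossing (F `|` F0)].
have [|F [[FQ crF] Fmax]] := @Zorn_bigcup _ fam.
  move=> C Cfam totC; split; first by move=> s [F /Cfam[FQ _] /FQ].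
  move=> s t [[F CF Fs]|F0s] [[F' CF' F't]|F0t].
  - have [_ crF] := Cfam _ CF; have [_ crF'] := Cfam _ CF'.
    have [FF'|F'F] := totC _ _ CF CF'.
      by apply: crF'; left => //; exact: FF'.
    by apply: crF; left => //; exact: F'F.
  - by have [_ crF] := Cfam _ CF; apply: crF; [left|right].
  - by have [_ crF'] := Cfam _ CF'; apply: crF'; [right|left].
  - exact: cr0.
exists (F `|` F0); split=> //.
- by move=> s [/FQ|/F0Q].
move=> s Qs Fs; apply: contrapT => non.
have crs t : (F `|` F0) t -> sep_cross t s.
  by move=> Ft ts; apply: non; exists t.
apply: (Fmax (F `|` [set s])).
  split; first by move=> x; left.
  by move=> /(_ s (or_intror erefl)) ?; apply: Fs; left.
split; first by move=> x [/FQ|->].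
move=> x y; rewrite -!setUA (setUC [set s]) !setUA.
move=> [Fx|->] [Fy|->] xy //; first exact: crF.
  exact: crs.
by apply: cross_sym; exact: crs.
Qed.

Hypothesis discS : discrete S.
Hypothesis cfinS : crossing_finite S.

(* Members of a maximal crossing family F of separations with X on both sides
   are oriented arbitrarily; every other such separation lies strictly above
   exactly one orientation of a member of F and this orients it. *)
Lemma orientation_ex (X : set G) (F0 : set (sep G)) :
  (forall s, S s -> X `<=` s.1 \/ X `<=` s.2) ->
  chain_free (@sep_lt G) [set s | S s /\ X `&` (s.1 `\` s.2) !=set0] ->
  F0 `<=` [set s | [/\ S s, X `<=` s.1 & X `<=` s.2]] ->
  pairwise_crossing F0 ->
  exists u, [/\ orientation S u, F0 `<=` u, forall s, u s -> X `<=` s.1 &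
    forall s t, F0 s -> u t -> ~ sep_lt t s].
Proof.
move=> XS.
(* [P] holds the separations whose choice is forced by [X]; on [Q] either choice keeps [X] on the
   first side. *)
set P := [set s | S s /\ _]; set Q := [set s | [/\ _, _ & _]] => noP F0Q cr0.
have [F [F0F FQ crF Fmax]] := maximal_crossing F0Q cr0.
pose FF := F `|` [set s | F (flip s)].
have PS : P `<=` S by move=> s [].
have QS : Q `<=` S by move=> s [].
have Qflip s : Q s -> Q (flip s) by move=> [Ss ? ?]; split=> //; exact: system_flip.
have FFQ : FF `<=` Q by move=> s [/FQ//|/FQ/Qflip]; rewrite flipK.
have notPQ s : P s -> ~ Q s by move=> [_ [x [Xx [_ xs]]]] [_ _ /(_ x Xx)].
have notPP s : P s -> ~ P (flip s).
  move=> [Ss [x [Xx [xs1 xs2]]]] [_ [y [Xy [ys1 ys2]]]].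
  by have [/(_ y Xy)|/(_ x Xx)] := XS s Ss.
have tri s : S s -> [\/ P s, P (flip s) | Q s].
  move=> Ss; have [Xs1|/existsNP[x /not_implyP[Xx xs1]]] := pselect (X `<=` s.1);
   have [Xs2|/existsNP[y /not_implyP[Xy ys2]]] := pselect (X `<=` s.2).
  - by apply: Or33.
  - by apply: Or31; split=> //; exists y; split=> //; split=> //; exact: Xs1.
  - apply: Or32; split; first exact: system_flip.
    by exists x; split=> //; split=> //; exact: Xs2.
  - by have [/(_ x Xx)|/(_ y Xy)] := XS s Ss.
have Pup s t : P s -> S t -> sep_le s t -> P t.
  move=> [_ [x [Xx [xs1 xs2]]]] St [st1 st2]; split=> //; exists x; split=> //.
  by split; [exact: st1|move=> /st2].
have antiFF e e' : FF e -> FF e' -> sep_le e e' -> e = e'.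
  move=> Fe Fe' le; apply: contrapT => ne.
  have [eq|ne'] := pselect (e' = flip e).
    by move: le; rewrite eq; apply: not_le_flip; exact/QS/FFQ.
  have ne'' : flip e' <> e by move=> eq; apply: ne'; rewrite -eq flipK.
  case: Fe Fe' => [Fe|Fe] [Fe'|Fe'].
  - by apply: (crF e e') => //; left; left.
  - by apply: (crF e (flip e')) => //; [exact: nesym|right; left; rewrite flipK].
  - by apply: (crF (flip e) e') => //; [exact: nesym|right; right; apply/sep_le_flip].
  - apply: (crF (flip e) (flip e')) => //; last by left; right; apply/sep_le_flip.
    by move=> /(congr1 (@flip G)); rewrite !flipK.
pose above t := exists2 e, FF e & sep_lt e t.
have above_up s t : FF s \/ above s -> sep_lt s t -> above t.
  by case=> [Fs|[e Fe es]] st; [exists s|exists e => //; exact: sep_lt_trans st].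
have notFFabove s : FF s -> ~ above s.
  by move=> Fs [e Fe [es nes]]; apply: nes; exact: antiFF.
have notabove2 s : above s -> ~ above (flip s).
  move=> [e Fe es] [e' Fe' /sep_lt_flip]; rewrite flipK => se'.
  have ee' := sep_lt_trans es se'; have [le ne] := ee'; apply: ne.
  by apply: antiFF le => //; case: Fe'; [right; rewrite /= flipK|left].
have FFflip s : FF s -> FF (flip s) by case; [right; rewrite /= flipK|left].
have abovetot s : Q s -> ~ FF s -> above s \/ above (flip s).
  move=> Qs nFs; have [|t Ft] := Fmax s Qs; first by move=> ?; apply: nFs; left.
  have tF : FF t by left.
  have nts : t <> s by move=> e; apply: nFs; rewrite -e.
  have nts' : t <> flip s by move=> e; apply: nFs; right; rewrite /= -e.
  case=> -[] le.
  - by left; exists t.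
  - right; exists (flip t); first exact: FFflip.
    by apply: sep_lt_flip; split=> //; exact: nesym.
  - by right; exists t.
  - left; exists (flip t); first exact: FFflip.
    by rewrite -(flipK s); apply: sep_lt_flip; split=> //; exact: nesym.
have finFF : finite_set FF.
  have finF : finite_set F by apply: cfinS => // s /FQ/QS.
  rewrite finite_setU; split=> //.
  apply: (@sub_finite_set _ _ (@flip G @` F)); last exact: finite_image.
  by move=> s Fs; exists (flip s) => //; rewrite flipK.
(* Forced choices, the arbitrary choice [F] from the antichain [FF], and whatever this antichain
   decides among the rest. *)
pose u := [set t | [\/ P t, F t | Q t /\ above t]].
have uS : u `<=` S by move=> s [/PS|/FQ/QS|[/QS]].
have uFF s : u s -> P s \/ FF s \/ above s.
  by case=> [|?|[]]; [left|right; left; left|right; right].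
have uQ s : Q s -> u s -> FF s \/ above s.
  by move=> Qs /uFF[/notPQ|].
exists u; split.
- split=> //.
  + move=> s Ss; split=> [us' us|nus].
      have [Ps|Ps|Qs] := tri s Ss.
      * by case: us' => [/(notPP _ Ps)//|/FQ/Qflip|[/Qflip + _]]; rewrite flipK;
          exact: notPQ.
      * by case: us => [/notPP//|/FQ/Qflip|[/Qflip + _]]; exact: notPQ.
      * have Qs' := Qflip s Qs.
        case: us' us => [/notPQ//|Fs'|[_ as']] [/notPQ//|Fs|[_ as_]].
        - have ne : s <> flip s.
            by move=> e; apply: (not_le_flip Ss); rewrite -e; exact: sep_lexx.
          by apply: (crF _ _ Fs Fs' ne); right; left; rewrite flipK; exact: sep_lexx.
        - by apply: notFFabove as_; right.
        - by apply: notFFabove as'; apply: FFflip; left.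
        - exact: notabove2 as'.
    have [Ps|Ps|Qs] := tri s Ss; [by case: nus; apply: Or31|by apply: Or31|].
    have [Fs|nFs] := pselect (FF s).
      case: Fs => Fs; last by apply: Or32.
      by case: nus; apply: Or32.
    case: (abovetot s Qs nFs) => as_; first by case: nus; apply: Or33.
    by apply: Or33; split=> //; exact: Qflip.
  + move=> s t us St st; have [Ps|nPs] := pselect (P s).
      by apply: Or31; exact: Pup st.
    have [<-//|lt] := sep_le_eqVlt st.
    have Fs : FF s \/ above s by have [] := uFF s us.
    have Qs : Q s by case: us => [//|/FQ|[]].
    have [Pt|Pt|Qt] := tri t St; first by apply: Or31.
      case: (notPQ _ Pt); apply: Qflip; case: Qs => _ Xs1 Xs2; split=> //.
        exact: subset_trans st.1.
      exfalso; case: Pt => _ [x [Xx [_ /= xt]]]; apply: xt.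
      by apply: st.1; exact: Xs1.
    by apply: Or33; split=> //; exact: above_up Fs lt.
  + move=> [f fP]; have [allP|] := pselect (forall n, P (f n)).
      by apply: noP; exists f => n; have [] := fP n.
    (* [P] is upward closed, so once the chain leaves [P] it never returns. Its tail then lies in
       the intervals from members of the finite set [FF] up to [g 0], which are finite by
       discreteness. *)
    move=> /existsNP[n0 nP0]; pose g k := f (n0 + k).
    have g0 k : sep_le (g k) (g 0).
      elim: k => [|k IH]; first exact: sep_lexx.
      have [_ [le _]] := fP (n0 + k).
      by apply: sep_le_trans IH; rewrite /g addnS.
    have gQ k : FF (g k) \/ above (g k).
      have [uk _] := fP (n0 + k); have [Pk|] := uFF _ uk => //.
      case: nP0; have := g0 k; rewrite {2}/g addn0; apply: Pup => //.
      by apply: uS; have [] := fP n0.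
    have fin : finite_set (\bigcup_(e in FF) [set t | [/\ S t, sep_le e t & sep_le t (g 0)]]).
      apply: bigcup_finite => // e Fe; apply: discS; first exact/QS/FFQ.
      by apply: uS; have [] := fP (n0 + 0).
    apply: (finite_chain_free (@sep_lt_irr G) (@sep_lt_trans G) fin).
    exists g => k; split; last by rewrite /g addnS; have [] := fP (n0 + k).
    have Sk : S (g k) by apply: uS; have [] := fP (n0 + k).
    by have [Fg|[e Fe [eg _]]] := gQ k; [exists (g k) => //; split; rewrite //; exact: sep_lexx|exists e].
- by move=> s /F0F; exact: Or32.
- move=> s [[Ss [x [Xx [_ xs]]]]|/FQ[]//|[[]//]].
  by have [//|/(_ x Xx)] := XS s Ss.
- move=> s t F0s ut ts; have Fs : FF s by left; exact: F0F.
  case: (uFF t ut) => [Pt|/above_up/(_ ts)]; last exact: notFFabove.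
  by apply: (notPQ s); [apply: Pup Pt _ ts.1; exact/QS/F0Q|exact: F0Q].
Qed.

End SeparationSystem.

(** * The graph of orientations *)

Section FiniteCardinal.
Variable T : choiceType.
Implicit Types A B : set T.

(** A junk value when [A] is infinite, hence the finiteness hypotheses below. *)
Definition fcard A := #|` fset_set A|.

Lemma fcard_sub A B : finite_set B -> A `<=` B -> fcard A <= fcard B.
Proof.
move=> finB AB; apply: fsubset_leq_card.
by rewrite -fset_set_sub//; exact: sub_finite_set finB.
Qed.

Lemma fcardU A B : finite_set A -> finite_set B -> A `&` B = set0 ->
  fcard (A `|` B) = fcard A + fcard B.
Proof.
move=> finA finB AB; rewrite /fcard fset_setU// -cardfsUI -fset_setI// AB.
by rewrite fset_set0 cardfs0 addn0.
Qed.

Lemma fcardU_le A B : finite_set A -> finite_set B ->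
  fcard (A `|` B) <= fcard A + fcard B.
Proof. by move=> finA finB; rewrite /fcard fset_setU// -cardfsUI leq_addr. Qed.

Lemma fcard_eq_sub A B : finite_set B -> A `<=` B -> fcard A = fcard B -> A = B.
Proof.
move=> finB AB eAB; have finA := sub_finite_set AB finB.
apply: fset_set_inj => //; apply/eqP; rewrite eqEfcard; apply/andP; split.
  by rewrite -fset_set_sub.
by rewrite -/(fcard A) eAB.
Qed.

End FiniteCardinal.

Section Construction.
Variables (G : graph) (S : set (sep G)).
Hypothesis sysS : separation_system S.
Implicit Types (s t : sep G) (u v w : set (sep G)).

Lemma orientation_flipN u s : orientation S u -> u s -> ~ u (flip s).
Proof. by move=> ou us; rewrite (orientation_flip ou)//; exact: orientation_sub us. Qed.

Lemma orientation_flipV u s : orientation S u -> S s -> ~ u s -> u (flip s).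
Proof. by move=> ou Ss /(orientation_flip ou Ss). Qed.

Lemma orientation_subset u v : orientation S u -> orientation S v ->
  u `<=` v -> u = v.
Proof.
move=> ou ov uv; apply/seteqP; split=> // s vs; apply: contrapT => us.
have Ss := orientation_sub ov vs.
exact: (orientation_flipN ov vs (uv _ (orientation_flipV ou Ss us))).
Qed.

Lemma orientation_diff_flip u v s : orientation S u -> orientation S v ->
  (u `\` v) s -> (v `\` u) (flip s).
Proof.
move=> ou ov [us vs]; split; last exact: orientation_flipN.
by apply: orientation_flipV => //; exact: orientation_sub us.
Qed.

(** Upward closure could fail only above [flip s] or at [s]. If [flip s] is strictly below a [t]
    missing from [u], then [flip t] is in [u] and strictly below [s]; and nothing else in [u] is
    below [s]. Both use minimality. *)
Lemma flip_minimal u s : orientation S u -> u s ->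
  (forall t, u t -> ~ sep_lt t s) -> orientation S ((u `\ s) `|` [set flip s]).
Proof.
move=> ou us smin; have Ss := orientation_sub ou us.
have fs : flip s <> s by move=> e; apply: (orientation_flipN ou us); rewrite e.
split.
- by move=> t [[/(orientation_sub ou)]|->] //; exact: system_flip.
- move=> t St; have [->|ts] := pselect (t = s).
    by split=> [_ [[_ /(_ erefl)]//|/esym/fs]|_]//; right.
  have [->|tfs] := pselect (t = flip s).
    rewrite flipK; split=> [[[_ /(_ erefl)]//|/esym/fs//]|nfs].
    by case: nfs; right.
  have ftfs : flip t <> flip s by move=> /(congr1 (@flip G)); rewrite !flipK.
  have fts : flip t <> s by move=> e; apply: tfs; rewrite -e flipK.
  split=> [[[uft _]|//] [[ut _]|//]|nt]; first exact: (orientation_flipN ou ut).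
  left; split=> //; apply: orientation_flipV => // ut; apply: nt.
  by left.
- move=> r t [[ur rs]|->] St le.
    have ut := orientation_up ou ur St le.
    by left; split=> // ts; apply: (smin r ur); rewrite -ts; split=> // rt; apply: rs; rewrite rt.
  have [->|tfs] := pselect (t = flip s); first by right.
  left; split=> [|ts]; last first.
    by apply: (not_le_flip sysS (system_flip sysS Ss)); rewrite flipK -{2}ts.
  apply: contrapT => /(orientation_flipV ou St)/smin; apply.
  rewrite -(flipK s); apply: sep_lt_flip; split=> //.
  exact: nesym.
- apply: chain_freeU; first exact: sep_lt_trans.
    by apply: chain_freeS (orientation_dcc ou) => t [].
  apply: finite_chain_free; [exact: sep_lt_irr|exact: sep_lt_trans|].
  exact: finite_set1.
Qed.

Definition majority u v w := [set s | [\/ u s /\ v s, v s /\ w s | w s /\ u s]].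

Lemma majority_orientation u v w : orientation S u -> orientation S v ->
  orientation S w -> orientation S (majority u v w).
Proof.
move=> ou ov ow; split.
- by move=> s [[/(orientation_sub ou)]|[/(orientation_sub ov)]|[/(orientation_sub ow)]].
- move=> s Ss; have := orientation_flip ou Ss; have := orientation_flip ov Ss.
  have := orientation_flip ow Ss; rewrite /majority /= => hw hv hu.
  split=> [h [] []|h].
  + by case: h => -[]; tauto.
  + by case: h => -[]; tauto.
  + by case: h => -[]; tauto.
  have [us|us] := pselect (u s); have [vs|vs] := pselect (v s);
    have [ws|ws] := pselect (w s); first [by case: h; first [by apply: Or31
      | by apply: Or32|by apply: Or33]|by apply: Or31; tauto|by apply: Or32; tauto
      |by apply: Or33; tauto].
- move=> s t [[]|[]|[]] h1 h2 St st;
    [apply: Or31|apply: Or32|apply: Or33]; split; by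
    [exact: orientation_up h1 St st|exact: orientation_up h2 St st].
(* Any two of the three voters include [u] or [v]. *)
- apply: (@chain_freeS _ _ (u `|` v)).
    by move=> s [[? ?]|[? ?]|[? ?]]; [left|right|left].
  by apply: chain_freeU;
    [exact: sep_lt_trans|exact: orientation_dcc ou|exact: orientation_dcc ov].
Qed.

Hypothesis cfinS : crossing_finite S.

(* Elements of [u `\` v] are pairwise comparable or crossing. *)
Lemma orientation_diff_finite u v : orientation S u -> orientation S v ->
  finite_set (u `\` v).
Proof.
move=> ou ov; apply: (@finite_of_chain_free _ (@sep_lt G)).
- exact: sep_lt_trans.
- by apply: chain_freeS (orientation_dcc ou) => s [].
(* Flipping turns an ascending chain of [u] outside [v] into a descending chain of [v]. *)
- move=> [f fP]; apply: (orientation_dcc ov); exists (fun n => flip (f n)) => n.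
  have [fu lt] := fP n; split; last exact: sep_lt_flip.
  by have [] := orientation_diff_flip ou ov fu.
- move=> A Auv anti; apply: cfinS; first by move=> s /Auv[/(orientation_sub ou)].
  move=> s t As At st.
  have [us vs] := Auv _ As; have [ut vt] := Auv _ At.
  have Ss := orientation_sub ou us; have St := orientation_sub ou ut.
  case=> -[] le.
  + exact: (anti s t).
  + by apply: (anti t s) => //; split=> //; exact: nesym.
  + apply: (orientation_flipN ou ut).
    by apply: (orientation_up ou us _ le); exact: system_flip.
  + exact/vs/(orientation_up ov (orientation_flipV ov St vt) Ss le).
Qed.

Definition median_vertex := {u : set (sep G) | orientation S u}.
Implicit Types x y z : median_vertex.

(** One difference suffices: by [diff_set1_flip] the opposite one is then the singleton of the
    flip. *)
Definition median_adj x y := `[< exists s, sval x `\` sval y = [set s] >].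

Lemma vertex_eq x y : sval x = sval y -> x = y.
Proof. by case: x y => [u ou] [v ov] /= e; exact: eq_exist. Qed.

Lemma diff_set1_flip x y s : sval x `\` sval y = [set s] ->
  sval y `\` sval x = [set flip s].
Proof.
move=> xy; apply/seteqP; split=> [t tyx|_ ->].
  have := orientation_diff_flip (svalP y) (svalP x) tyx.
  by rewrite xy => /= <-; rewrite flipK.
by apply: orientation_diff_flip (svalP x) (svalP y) _; rewrite xy.
Qed.

Lemma median_adj_sym : symmetric median_adj.
Proof.
by move=> x y; apply/asboolP/asboolP => -[s /diff_set1_flip]; exists (flip s).
Qed.

Lemma median_adj_irr : irreflexive median_adj.
Proof.
move=> x; apply/negP => /asboolP[s]; rewrite setDv => e.
by have : [set s] s by []; rewrite -e.
Qed.

Definition orientation_graph := Graph median_adj_sym median_adj_irr.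

Local Notation M := orientation_graph.

Lemma adj_diff (x y : M) : adj x y -> exists s, sval x `\` sval y = [set s].
Proof. by move=> /asboolP. Qed.

Lemma diff_finite x y : finite_set (sval x `\` sval y).
Proof. exact: orientation_diff_finite (svalP x) (svalP y). Qed.

(** Exactly one of [s] and [flip s] lies in this difference whenever [x] and [y] disagree on them,
    so each disagreement counts once. *)
Definition cut_size x y := fcard (sval x `\` sval y).

Lemma walk_cut_size (x y : M) p : walk x y p -> cut_size x y <= size p.
Proof.
elim: p x => [|z p IH] x.
  by case=> _ <-; rewrite /cut_size setDv /fcard fset_set0 cardfs0.
case=> /= /andP[xz zp] lp; have [s xzs] := adj_diff xz.
have /IH le : walk z y p by [].
apply: (@leq_trans (fcard ([set s] `|` (sval z `\` sval y)))).
  apply: fcard_sub.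
    by rewrite finite_setU; split; [exact: finite_set1|exact: diff_finite].
  rewrite -xzs => r [xr yr].
  by have [zr|zr] := pselect (sval z r); [right|left].
apply: leq_trans (fcardU_le (finite_set1 _) (diff_finite _ _)) _.
by rewrite {1}/fcard fset_set1 cardfs1 add1n ltnS.
Qed.

Lemma flip_vertex x s : sval x s -> (forall t, sval x t -> ~ sep_lt t s) ->
  exists2 y : M, sval y = (sval x `\ s) `|` [set flip s] &
    sval x `\` sval y = [set s].
Proof.
move=> xs smin; have oy := flip_minimal (svalP x) xs smin.
exists (exist _ _ oy) => //=; apply/seteqP; split=> [r [xr yr]|_ ->].
  by apply: contrapT => rs; apply: yr; left.
split=> // -[[_]|] //= e; apply: (orientation_flipN (svalP x) xs).
by rewrite -e.
Qed.

(** Flipping a minimal element of [sval x] outside [sval y] brings [x] one step closer to [y]. *)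
Lemma cut_size_walk (x y : M) : exists2 p, walk x y p & size p = cut_size x y.
Proof.
have [n] := ubnP (cut_size x y); elim: n x => // n IH x lt.
have [xy|/existsNP[s0 /not_implyP[xs0 ys0]]] := pselect (sval x `<=` sval y).
  have -> : x = y.
    by apply: vertex_eq; exact: orientation_subset (svalP x) (svalP y) xy.
  by exists [::] => //; rewrite /cut_size setDv /fcard fset_set0 cardfs0.
have [s [[xs ys] _ smin]] := minimal_below (@sep_lt_trans G)
  (orientation_dcc (svalP x)) (@subDsetl _ (sval x) (sval y)) (conj xs0 ys0).
(* Minimality in the difference gives minimality in [sval x]: an element of [sval y] below [s] would
   put [s] in [sval y]. *)
have sminx t : sval x t -> ~ sep_lt t s.
  move=> xt ts; apply: (smin t) => //; split=> // yt; apply: ys.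
  exact: (orientation_up (svalP y) yt (orientation_sub (svalP x) xs) ts.1).
have [z zE xz] := flip_vertex xs sminx.
have size_z : cut_size x y = (cut_size z y).+1.
  rewrite /cut_size -add1n -(cardfs1 s) -(fset_set1 s) -fcardU.
  - congr fcard; apply/seteqP; split=> r; rewrite zE.
      move=> [xr yr]; have [->|rs] := pselect (r = s); first by left.
      by right; split=> //; left.
    move=> [->//|[[[xr _]|->] yr]] //; case: yr.
    by apply: (orientation_flipV (svalP y)) => //; exact: (orientation_sub (svalP x) xs).
  - exact: finite_set1.
  - exact: diff_finite.
  - apply/seteqP; split=> // r [->]; rewrite zE => -[[[_ /(_ erefl)]|] //= + _].
    by move=> e; apply: (orientation_flipN (svalP x) xs); rewrite -e.
have [|p zyp sp] := IH z; first by move: lt; rewrite size_z.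
exists (z :: p); last by rewrite size_z /= sp.
by apply: walk_cons zyp; apply/asboolP; exists s.
Qed.

Lemma dist_cut_size (x y : M) : dist x y = cut_size x y.
Proof.
have [p xyp sp] := cut_size_walk x y; have [[q xyq sq] le] := dist_min xyp.
by apply/eqP; rewrite eqn_leq -{1}sp le -sq walk_cut_size.
Qed.

(** The difference from [x] to [y] is always contained in the disjoint union of those from [x] to
    [z] and from [z] to [y]. Equal distances mean that these finite sets coincide. *)
Lemma between_orientations (x y z : M) :
  dist x z + dist z y = dist x y <-> sval x `&` sval y `<=` sval z.
Proof.
have sub : sval x `\` sval y `<=` (sval x `\` sval z) `|` (sval z `\` sval y).
  by move=> s [xs ys]; have [zs|zs] := pselect (sval z s); [right|left].
have fin : finite_set ((sval x `\` sval z) `|` (sval z `\` sval y)).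
  by rewrite finite_setU; split; exact: diff_finite.
rewrite !dist_cut_size /cut_size -fcardU; [|exact: diff_finite|exact: diff_finite|]; last first.
  by apply/seteqP; split=> // s [[_ zs] [/zs]].
split=> [/esym/(fcard_eq_sub fin sub) e s [xs ys]|h].
  apply: contrapT => zs; have : (sval x `\` sval y) s by rewrite e; left.
  by case.
congr fcard; apply/seteqP; split=> // s [[xs zs]|[zs ys]].
  by split=> // ys; apply: zs; exact: h.
split=> //; apply: contrapT => xs; have Ss := orientation_sub (svalP z) zs.
apply: (orientation_flipN (svalP z) zs); apply: h.
by split; apply: orientation_flipV => //; exact: svalP.
Qed.

(** Passing from [x] to [y] loses only [s] and gains only its flip. So [y] lies between [w] and [x]
    if [w] lacks [s], and [x] lies between [w] and [y] otherwise. *)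
Lemma halfspace_label (x y : M) s : sval x `\` sval y = [set s] ->
  halfspace (x, y) = [set w | sval w s].
Proof.
move=> xys; have yxs := diff_set1_flip xys.
have xs : (sval x `\` sval y) s by rewrite xys.
have conM : connected M.
  split; first by exists.
  by move=> u v; have [p] := cut_size_walk u v; exists p.
have xy : adj x y by apply/asboolP; exists s.
have yx : adj y x by rewrite adj_sym.
have Ss := orientation_sub (svalP x) xs.1.
apply/seteqP; split=> w; rewrite /halfspace/= => h.
  apply: contrapT => ws; have ws' := orientation_flipV (svalP w) Ss ws.
  suff : dist w y + dist y x = dist w x.
    by rewrite (dist_adj conM yx) => e; move: h; rewrite -e addn1 ltnNge leqnSn.
  apply/between_orientations => t [wt xt]; apply: contrapT => yt.
  have : (sval x `\` sval y) t by [].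
  by rewrite xys => /= ts; apply: ws; rewrite -ts.
suff : dist w x + dist x y = dist w y by rewrite (dist_adj conM xy) => <-; rewrite addn1.
apply/between_orientations => t [wt yt]; apply: contrapT => xt.
have : (sval y `\` sval x) t by [].
by rewrite yxs => /= ts; apply: (orientation_flipN (svalP w) h); rewrite -ts.
Qed.

End Construction.

(** * Existence *)

Definition edge_sep (G M : graph) (beta : M -> set G) (e : M * M) : sep G :=
  (\bigcup_(u in halfspace e) beta u, \bigcup_(u in halfspace (swap e)) beta u).

Lemma induced_sepE (G M : graph) (beta : M -> set G) (e : M * M) :
  median_graph M -> oriented_edge e ->
  induced_sep beta (Theta_class e) = edge_sep beta e.
Proof. by move=> medM ee; rewrite /induced_sep hplusE// hminusE. Qed.

Section Existence.
Variables (G : graph) (S : set (sep G)).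
Hypothesis sysS : separation_system S.
Hypothesis discS : discrete S.
Hypothesis cfinS : crossing_finite S.
Hypothesis eccS : ECC S.

Local Notation M := (orientation_graph S).
Implicit Types (x y w : M) (s t : sep G) (a b : G).

Definition bag (x : M) : set G := [set a | forall s, sval x s -> s.1 a].

Lemma vertex_ex (X : set G) (F0 : set (sep G)) :
  (forall s, S s -> X `<=` s.1 \/ X `<=` s.2) ->
  chain_free (@sep_lt G) [set s | S s /\ X `&` (s.1 `\` s.2) !=set0] ->
  F0 `<=` [set s | [/\ S s, X `<=` s.1 & X `<=` s.2]] ->
  pairwise_crossing F0 ->
  exists x : M, [/\ F0 `<=` sval x, X `<=` bag x &
    forall s t, F0 s -> sval x t -> ~ sep_lt t s].
Proof.
move=> XS noP F0Q cr0; have [u [ou F0u Xu mu]] :=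
  orientation_ex sysS discS cfinS XS noP F0Q cr0.
by exists (exist _ u ou); split=> // a Xa s us; exact: Xu us _ Xa.
Qed.

Lemma pairwise_crossing0 : pairwise_crossing (set0 : set (sep G)).
Proof. by []. Qed.

Lemma pairwise_crossing1 s : pairwise_crossing [set s].
Proof. by move=> ? ? -> ->. Qed.

Lemma orientation_graph_connected : connected M.
Proof.
split; last by move=> x y; have [p] := cut_size_walk sysS cfinS x y; exists p.
(* The empty set forces no choice, so this only asks for some orientation. *)
have [| | |//|x _] := @vertex_ex set0 set0; last by exists.
- by move=> s _; left.
- by move=> [f /(_ 0)[[_ [a []]]]].
- by move=> s.
Qed.

Lemma orientation_graph_median : median_graph M.
Proof.
split; first exact: orientation_graph_connected.
move=> x y w; have conM := orientation_graph_connected.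
pose m : M := exist _ _ (majority_orientation (svalP x) (svalP y) (svalP w)).
exists m; have betP (u v z : M) : interval u v z <-> sval u `&` sval v `<=` sval z.
  rewrite (intervalP conM); exact: between_orientations.
apply/seteqP; split=> [z [[/betP xyz /betP ywz] /betP wxz]|_ ->]; last first.
  split; [split|]; apply/betP => s [h1 h2]; by
    [apply: Or31|apply: Or32|apply: Or33].
apply/esym/vertex_eq/(orientation_subset (svalP m) (svalP z)).
by move=> s /= [h|h|h]; [exact: xyz|exact: ywz|exact: wxz].
Qed.

Lemma escape a : chain_free (@sep_lt G) [set s | S s /\ (s.1 `\` s.2) a].
Proof.
move=> [f fP]; have := eccS (fun n => (fP n).1.1) (fun n => (fP n).2).
by apply/eqP/set0P; exists a => n _; have [[]] := fP n.
Qed.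

Lemma system_cover s a : S s -> s.1 a \/ s.2 a.
Proof.
move=> /sysS[[cov _] _ _].
by have : (s.1 `|` s.2) a by rewrite cov.
Qed.

(** For [a] on both sides of [s], the family [[set s]] imposes the choice of [s]. For [a] off [s.2],
    every vertex whose bag contains [a] has chosen [s]. *)
Lemma bag_halfspace s : S s -> \bigcup_(x in [set w : M | sval w s]) bag x = s.1.
Proof.
move=> Ss; apply/seteqP; split=> [a [x /= xs]|a sa]; first exact.
have XS t : S t -> [set a] `<=` t.1 \/ [set a] `<=` t.2.
  by move=> /(system_cover a)[]; [left|right] => ? ->.
have noP : chain_free (@sep_lt G) [set t | S t /\ [set a] `&` (t.1 `\` t.2) !=set0].
  by apply: chain_freeS (@escape a) => t [St [_ [->]]].
have [sa2|sa2] := pselect (s.2 a).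
  have [|x [xs xa _]] := vertex_ex XS noP _ (@pairwise_crossing1 s).
    by move=> _ ->; split=> // _ ->.
  by exists x; [exact: xs|exact: xa].
have [|x [_ xa _]] := vertex_ex XS noP _ pairwise_crossing0; first by [].
exists x; last exact: xa.
apply: contrapT => /(orientation_flipV (svalP x) Ss) /(xa a erefl).
exact: sa2.
Qed.

(** Starting the crossing family with [s] yields an orientation in which [s] is minimal and can be
    flipped. *)
Lemma label_ex s : S s -> exists x y, sval x `\` sval y = [set s].
Proof.
move=> Ss; have [| | |x [xs _ smin]] :=
  @vertex_ex set0 [set s] _ _ _ (@pairwise_crossing1 s).
- by move=> t _; left.
- by move=> [f /(_ 0)[[_ [a []]]]].
- by move=> _ ->; split=> //; exact: sub0set.
have [|y _ xy] := flip_vertex sysS (xs s erefl); first by move=> t; exact: smin.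
by exists x, y.
Qed.

Lemma edge_label x y s : sval x `\` sval y = [set s] -> edge_sep bag (x, y) = s.
Proof.
move=> xys; have yxs := diff_set1_flip xys.
have Ss : S s.
  have [xs _] : (sval x `\` sval y) s by rewrite xys.
  exact: (orientation_sub (svalP x) xs).
rewrite /edge_sep (halfspace_label sysS cfinS xys) (halfspace_label sysS cfinS yxs).
by rewrite !bag_halfspace//; [case: s {xys yxs Ss}|exact: system_flip].
Qed.

(** No edge joins the two strict sides of a separation, so the pair lies within one side of each. A
    separation forced by the pair is forced by one end, and the chain conditions at both ends
    combine. *)
Lemma bag_edge a b : adj a b -> exists x, bag x a /\ bag x b.
Proof.
move=> ab.
have XS t : S t -> [set a; b] `<=` t.1 \/ [set a; b] `<=` t.2.
  move=> St; have [[_ noedge] _ _] := sysS St.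
  have ca := system_cover a St; have cb := system_cover b St.
  have := noedge a b; have := noedge b a; rewrite adj_sym ab.
  have [a1|a1] := pselect (t.1 a); have [b1|b1] := pselect (t.1 b).
  - by left=> _ [] ->.
  - have b2 : t.2 b by case: cb.
    have [a2|a2] := pselect (t.2 a); first by right=> _ [] ->.
    by move=> _ /(_ (conj a1 a2) (conj b2 b1)).
  - have a2 : t.2 a by case: ca.
    have [b2|b2] := pselect (t.2 b); first by right=> _ [] ->.
    by move=> /(_ (conj b1 b2) (conj a2 a1)).
  - by right=> _ [] ->; [case: ca|case: cb].
have [| |//|x [_ xab _]] := @vertex_ex _ set0 XS; last first.
- by exists x; split; apply: xab; [left|right].
- by [].
apply: chain_freeS (chain_freeU (@sep_lt_trans G) (@escape a) (@escape b)).
by move=> t [St [_ [[->|->] ta]]]; [left|right].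
Qed.

Lemma bag_cover : \bigcup_x bag x = setT.
Proof.
apply/seteqP; split=> // a _.
have [| | |//|x [_ xa _]] := @vertex_ex [set a] set0.
- by move=> t /(system_cover a)[]; [left|right] => ? ->.
- by apply: chain_freeS (@escape a) => t [St [_ [->]]].
- by [].
by exists x => //; exact: xa.
Qed.

Lemma bag_decomposition : median_decomposition bag.
Proof.
split; [exact: orientation_graph_median|exact: bag_cover|exact: bag_edge|].
(* Every [s] chosen at [z] is chosen at [x] or [y]: otherwise its flip is common to both, hence
   chosen at [z] too. *)
move=> a; apply/(convexP orientation_graph_connected) => x y z xa ya.
move=> /(between_orientations sysS cfinS) xyz s zs.
have Ss := orientation_sub (svalP z) zs.
have [xs|xs] := pselect (sval x s); first exact: xa.
have [ys|ys] := pselect (sval y s); first exact: ya.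
case: (orientation_flipN (svalP z) zs); apply: xyz.
by split; [exact: orientation_flipV (svalP x) Ss xs|exact: orientation_flipV (svalP y) Ss ys].
Qed.

Lemma Theta_class_label (h : set (M * M)) : Theta_classes h ->
  exists x y, [/\ adj x y, h = Theta_class (x, y),
    sval x `\` sval y = [set induced_sep bag h] & S (induced_sep bag h)].
Proof.
move=> [[x y] xy <-]; have [s xys] := adj_diff xy.
have -> : induced_sep bag (Theta_class (x, y)) = s.
  by rewrite (induced_sepE _ orientation_graph_median xy) (edge_label xys).
exists x, y; split=> //; have [xs _] : (sval x `\` sval y) s by rewrite xys.
exact: (orientation_sub (svalP x) xs).
Qed.

Lemma hplus_label (h : set (M * M)) w : Theta_classes h ->
  hplus h w <-> sval w (induced_sep bag h).
Proof.
move=> /Theta_class_label[x [y [xy -> xys _]]].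
by rewrite hplusE ?(halfspace_label sysS cfinS xys)//; exact: orientation_graph_median.
Qed.

Lemma hminus_label (h : set (M * M)) w : Theta_classes h ->
  hminus h w <-> ~ sval w (induced_sep bag h).
Proof.
move=> /Theta_class_label[x [y [xy -> xys _]]].
have medM := orientation_graph_median.
by rewrite hminusE// halfspace_swap// (halfspace_label sysS cfinS xys).
Qed.

Lemma bag_reduced : reduced bag.
Proof.
split=> [h /Theta_class_label[x [y [_ _ _ /sysS[]]]]//|].
move=> h h' /set_mem hT /set_mem hT' e; have medM := orientation_graph_median.
have [x [y [xy hE xys _]]] := Theta_class_label hT.
have [x' [y' [xy' hE' xys' _]]] := Theta_class_label hT'.
rewrite hE hE'; apply/Theta_class_eqP => //.
by rewrite (halfspace_label sysS cfinS xys) (halfspace_label sysS cfinS xys') e.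
Qed.

(** Each of the four ways of being nested is refuted by upward closure at a vertex of one of the
    four quarters. *)
Lemma bag_crossing_faithful : crossing_faithful bag.
Proof.
move=> h h' hT hT' [pp pm mp mm].
have [_ [_ [_ _ _ Ss]]] := Theta_class_label hT.
have [_ [_ [_ _ _ St]]] := Theta_class_label hT'.
case: pp pm mp mm => [w1 [/hplus_label-/(_ hT) p1 /hplus_label-/(_ hT') p1']].
move=> [w2 [/hplus_label-/(_ hT) p2 /hminus_label-/(_ hT') p2']].
move=> [w3 [/hminus_label-/(_ hT) p3 /hplus_label-/(_ hT') p3']].
move=> [w4 [/hminus_label-/(_ hT) p4 /hminus_label-/(_ hT') p4']].
case=> -[] le.
- exact: p2' (orientation_up (svalP w2) p2 St le).
- exact: p3 (orientation_up (svalP w3) p3' Ss le).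
- apply: (orientation_flipN (svalP w1) p1').
  exact: (orientation_up (svalP w1) p1 (system_flip sysS St) le).
- apply: p4; apply: (orientation_up (svalP w4) _ Ss le).
  exact: orientation_flipV (svalP w4) St p4'.
Qed.

Lemma bag_induced_system : induced_system bag = S.
Proof.
apply/seteqP; split=> [_ [h hT <-]|s Ss].
  by have [x [y []]] := Theta_class_label hT.
have [x [y xys]] := label_ex Ss.
have xy : oriented_edge (x, y) by apply/asboolP; exists s.
exists (Theta_class (x, y)); first by exists (x, y).
by rewrite (induced_sepE _ orientation_graph_median xy) (edge_label xys).
Qed.

End Existence.

(** * Uniqueness *)

Section Uniqueness.
Variables (G : graph) (S : set (sep G)).
Hypothesis sysS : separation_system S.
Hypothesis cfinS : crossing_finite S.
Variables (N : graph) (alpha : N -> set G).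
Hypothesis decN : median_decomposition alpha.
Hypothesis redN : reduced alpha.
Hypothesis cfN : crossing_faithful alpha.
Hypothesis indN : induced_system alpha = S.

Local Notation M := (orientation_graph S).
Let medN : median_graph N := md_median decN.
Let conN : connected N := medN.1.
Implicit Types (x y z n : N) (e f : N * N) (s t : sep G).

Lemma edge_sep_system e : oriented_edge e -> S (edge_sep alpha e).
Proof.
move=> ee; rewrite -indN; exists (Theta_class e); first by exists e.
exact: induced_sepE.
Qed.

Lemma system_edge_sep s : S s -> exists2 e, oriented_edge e & s = edge_sep alpha e.
Proof.
by rewrite -indN => -[_ [e ee <-] <-]; exists e => //; rewrite induced_sepE.
Qed.

Lemma edge_sep_swap e : edge_sep alpha (swap e) = flip (edge_sep alpha e).
Proof. by case: e. Qed.

Lemma edge_sep_inj e f : oriented_edge e -> oriented_edge f ->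
  edge_sep alpha e = edge_sep alpha f -> halfspace e = halfspace f.
Proof.
move=> ee ef; rewrite -!(induced_sepE _ medN)// => h.
apply/(Theta_class_eqP medN ee ef); apply: redN.2 h; apply/mem_set;
  by [exists e|exists f].
Qed.

Lemma halfspace_edge_sep e f : oriented_edge e -> oriented_edge f ->
  halfspace e `<=` halfspace f -> sep_le (edge_sep alpha e) (edge_sep alpha f).
Proof.
move=> ee ef sub; split=> a [u /= hu au]; exists u => //; first exact: sub.
by move: hu; rewrite !(halfspace_swap medN)// => nfu /sub.
Qed.

(** Here crossing-faithfulness enters: nested separations come from classes that do not cross, so
    some quarter is empty. It is not the one containing [w]. Two of the others contradict
    essentiality; the third makes the separations equal, against injectivity. *)
Lemma edge_sep_halfspace e f : oriented_edge e -> oriented_edge f ->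
  sep_le (edge_sep alpha e) (edge_sep alpha f) -> halfspace e `<=` halfspace f.
Proof.
move=> ee ef le; apply: contrapT => /existsNP[w /not_implyP[ew fw]].
have eS := edge_sep_system ee; have fS := edge_sep_system ef.
have ee' := (oriented_edge_swap e).2 ee; have ef' := (oriented_edge_swap f).2 ef.
have ncr : ~ class_cross (Theta_class e) (Theta_class f).
  move=> cr; have := cfN _ _ cr; rewrite !induced_sepE//; apply; last by left; left.
    by exists e.
  by exists f.
have [h1|/nonemptyPn h1] := pselect (halfspace e `&` halfspace f !=set0); last first.
  apply: (not_le_both sysS eS fS le); rewrite -edge_sep_swap.
  apply: halfspace_edge_sep => // u eu; rewrite (halfspace_swap medN)// => fu.
  by have : (halfspace e `&` halfspace f) u by []; rewrite h1.
have [h2|/nonemptyPn h2] :=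
    pselect (halfspace (swap e) `&` halfspace (swap f) !=set0); last first.
  apply: (not_le_both sysS (system_flip sysS fS) (system_flip sysS eS)).
    exact/sep_le_flip.
  rewrite flipK -edge_sep_swap; apply: halfspace_edge_sep => // u fu.
  apply: contrapT => eu; have {}eu : halfspace (swap e) u by rewrite halfspace_swap.
  by have : (halfspace (swap e) `&` halfspace (swap f)) u by []; rewrite h2.
have [h3|/nonemptyPn h3] :=
    pselect (halfspace (swap e) `&` halfspace f !=set0); last first.
  have fe : halfspace f `<=` halfspace e.
    move=> u fu; apply: contrapT => eu.
    have : (halfspace (swap e) `&` halfspace f) u by rewrite (halfspace_swap medN).
    by rewrite h3.
  have /edge_sep_inj ef_eq : edge_sep alpha e = edge_sep alpha f.
    by apply: sep_le_anti => //; exact: halfspace_edge_sep.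
  by apply: fw; rewrite -ef_eq.
apply: ncr; rewrite /class_cross !hplusE// !hminusE//; split=> //.
by exists w; split=> //; rewrite (halfspace_swap medN).
Qed.

Definition orientation_at n : set (sep G) :=
  [set s | exists e, [/\ oriented_edge e, halfspace e n & s = edge_sep alpha e]].

Lemma orientation_atE e n : oriented_edge e ->
  orientation_at n (edge_sep alpha e) <-> halfspace e n.
Proof.
move=> ee; split=> [[f [ef fn /(edge_sep_inj ee ef) ->]]//|en].
by exists e.
Qed.

(** A chain would give strictly decreasing half-spaces, all separating [n] from the far end of the
    first edge; there are finitely many of those. *)
Lemma orientation_at_dcc n : chain_free (@sep_lt G) (orientation_at n).
Proof.
move=> [f fP].
have [e eP] := choice (fun k => (fP k).1).
have ek k : oriented_edge (e k) by have [] := eP k.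
have sub k : halfspace (e k.+1) `<=` halfspace (e k).
  apply: edge_sep_halfspace => //.
  by have [_ [le _]] := fP k; have [_ _ <-] := eP k; have [_ _ <-] := eP k.+1.
have sub0 k : halfspace (e k) `<=` halfspace (e 0).
  by elim: k => // k IH; apply: subset_trans (sub k) IH.
apply: (@finite_chain_free _ (fun A B : set N => A `<` B) _ _ _
  (separators_finite medN n (e 0).2)).
- by move=> A; exact: properxx.
- move=> A B C [AB BA] [BC _]; split; first exact: subset_trans BC.
  by move=> CA; apply: BA; exact: subset_trans CA.
exists (fun k => halfspace (e k)) => k; split; last first.
  split=> // ge; have [_ [_ ne]] := fP k; apply: ne.
  have [_ _ ->] := eP k; have [_ _ ->] := eP k.+1.
  by apply: sep_le_anti; exact: halfspace_edge_sep.
split; [by have [] := eP k|by move=> /sub0; exact: halfspace_snd|by exists (e k)].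
Qed.

Lemma orientation_at_orientation n : orientation S (orientation_at n).
Proof.
split; last exact: orientation_at_dcc.
- by move=> _ [e [ee _ ->]]; exact: edge_sep_system.
- move=> _ /system_edge_sep[e ee ->]; rewrite -edge_sep_swap !orientation_atE//.
    by rewrite (halfspace_swap medN).
  exact/oriented_edge_swap.
- move=> _ _ [e [ee en ->]] /system_edge_sep[f ef ->] le.
  by apply/orientation_atE => //; exact: edge_sep_halfspace le _ en.
Qed.

Definition vertex_at n : M := exist _ _ (orientation_at_orientation n).

Lemma vertex_at_inj : injective vertex_at.
Proof.
move=> x y /(congr1 sval) /= exy; apply: contrapT => /(separating_edge medN).
move=> [z xz]; apply; have ee : oriented_edge (x, z) by [].
apply/(orientation_atE _ ee); rewrite -exy; apply/(orientation_atE _ ee).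
exact: halfspace_fst.
Qed.

Lemma vertex_at_diff x y : adj x y ->
  orientation_at x `\` orientation_at y = [set edge_sep alpha (x, y)].
Proof.
move=> xy; have ee : oriented_edge (x, y) by [].
apply/seteqP; split=> [_ [[e [ee' ex ->]] /orientation_atE nye]|_ ->].
  have h := adj_halfspace medN xy ee' ex (nye ee').
  by apply: sep_le_anti; apply: halfspace_edge_sep => //; rewrite h.
split; first by apply/orientation_atE => //; exact: halfspace_fst.
by move=> /orientation_atE => /(_ ee); exact: (@halfspace_snd N (x, y)).
Qed.

(* If the class of [s] were not realised at [x], the first class met on the way
   from [x] to the other side of [s] would lie strictly below [s]. *)
Lemma vertex_at_step x (u : M) s : orientation_at x `\` sval u = [set s] ->
  exists2 y, adj x y & vertex_at y = u.
Proof.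
move=> xus; have ox := orientation_at_orientation x.
have [[e [ee ex sE]] us] : (orientation_at x `\` sval u) s by rewrite xus.
have ee' : oriented_edge (swap e) by exact/oriented_edge_swap.
have [| | |z xz] := @convex_separation _ medN (halfspace (swap e)) x.
- exact: halfspace_convex.
- by exists e.2; exact: (halfspace_fst medN ee').
- by rewrite (halfspace_swap medN).
rewrite (halfspace_swap medN)// => /subsetCr; rewrite setCK => sub.
have ez : oriented_edge (x, z) by [].
have xzx : orientation_at x (edge_sep alpha (x, z)).
  by apply/orientation_atE => //; exact: halfspace_fst.
have xzs : edge_sep alpha (x, z) = s.
  apply: contrapT => ne; apply: us.
  have ut : sval u (edge_sep alpha (x, z)).
    apply: contrapT => nu.
    by have : (orientation_at x `\` sval u) (edge_sep alpha (x, z)) by []; rewrite xus.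
  apply: (orientation_up (svalP u) ut); rewrite sE; first exact: edge_sep_system.
  exact: halfspace_edge_sep.
exists z => //; apply: vertex_eq; apply/esym.
(* Both [z] and [u] arise from [x] by flipping [s] alone, so their orientations agree. *)
have oz := orientation_at_orientation z.
apply: (orientation_subset (svalP u) oz) => t ut.
have St := orientation_sub (svalP u) ut; have xzd := vertex_at_diff xz.
apply: contrapT => zt; have [xt|xt] := pselect (orientation_at x t).
  have : (orientation_at x `\` orientation_at z) t by [].
  by rewrite xzd xzs => ts; apply: us; rewrite -ts.
have : (orientation_at x `\` sval u) (flip t).
  split; first exact: (orientation_flipV ox St xt).
  exact: (orientation_flipN (svalP u) ut).
rewrite xus => fts.
have [_] : (orientation_at x `\` orientation_at z) s by rewrite xzd xzs.
by apply; rewrite -fts; exact: (orientation_flipV oz St zt).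
Qed.

(** A walk from the image of some vertex to [u] is lifted edge by edge with [vertex_at_step]. *)
Lemma vertex_at_surj (u : M) : exists n, vertex_at n = u.
Proof.
have [[x] _] := conN; have [p xup _] := cut_size_walk sysS cfinS (vertex_at x) u.
elim: p x xup => [|w p IH] x [/=]; first by move=> _ <-; exists x.
move=> /andP[/adj_diff[s xw] wp] lp; have [y xy yw] := vertex_at_step xw.
by apply: (IH y); rewrite yw.
Qed.

Lemma vertex_at_adj x y : adj (vertex_at x) (vertex_at y) = adj x y.
Proof.
apply/idP/idP => [/adj_diff[s xys]|xy].
  by have [z xz /vertex_at_inj <-] := vertex_at_step xys.
by apply/asboolP; exists (edge_sep alpha (x, y)); exact: vertex_at_diff.
Qed.

(** If [a] is not in [alpha x], an edge at [x] has a half-space containing [x] and missing the whole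
    fibre of [a]. Its separation is chosen at [x], but its first side misses [a]. *)
Lemma bag_vertex_at x : bag (vertex_at x) = alpha x.
Proof.
apply/seteqP; split=> [a xa|a ax _ [e [_ ex ->]]]; last by exists x.
apply: contrapT => ax; pose C := [set u | alpha u a].
have [||z xz sub] := @convex_separation _ medN C x _ _ ax.
- exact: md_convex decN a.
- have : (\bigcup_u alpha u) a by rewrite (md_cover decN).
  by move=> [u _ ua]; exists u.
have ez : oriented_edge (x, z) by [].
have [|u xzu ua] := xa (edge_sep alpha (x, z)).
  by apply/orientation_atE => //; exact: halfspace_fst.
exact: sub ua xzu.
Qed.

Lemma bag_unique : exists2 phi : M -> N, graph_iso phi & (alpha \o phi)%FUN = @bag G S.
Proof.
have [phi phiK] := choice vertex_at_surj.
have phiK' n : phi (vertex_at n) = n by apply: vertex_at_inj.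
exists phi; last by apply/funext => u /=; rewrite -bag_vertex_at phiK.
by split=> [|u v]; [exists vertex_at|rewrite -vertex_at_adj !phiK].
Qed.

End Uniqueness.

Theorem theorem1p1 (G : graph) (S : set (sep G))
  (S_system : separation_system S) (S_discrete : discrete S)
  (S_crossing_finite : crossing_finite S) (S_ECC : ECC S) :
  exists (M : graph) (beta : M -> set G),
    [/\ median_decomposition beta, reduced beta, crossing_faithful beta
      & induced_system beta = S] /\
    (forall (N : graph) (alpha : N -> set G),
       median_decomposition alpha -> reduced alpha ->
       crossing_faithful alpha -> induced_system alpha = S ->
       exists2 phi : M -> N, graph_iso phi & (alpha \o phi)%FUN = beta).
Proof.
exists (orientation_graph S), (@bag G S); split; last first.
  by move=> N alpha dec red cf ind; exact: bag_unique.
split; [exact: bag_decomposition|exact: bag_reduced|exact: bag_crossing_faithful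
  |exact: bag_induced_system].
Qed.
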